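(* Let $(a,b)\subseteq\mathbb{R}$ be an open interval with $a<b$, and let $f, F:(a,b)\to\mathbb{R}$ be given functions (no regularity is assumed). Then $f$ and $F$ satisfy the inequalities $$ f\Big(\frac{x+y}{2}\Big)\leq \frac{F(y)-F(x)}{y-x}\leq \frac{f(x)+f(y)}{2}\quad\text{for all } x, y\in (a,b),\ x\neq y, $$ if and only if $f$ is a convex function and $F$ is a primitive function of $f$.
   Context: A function $f:(a,b)\to\mathbb{R}$ is convex if $f(\lambda x+(1-\lambda)y)\leq \lambda f(x)+(1-\lambda)f(y)$ for all $x,y\in(a,b)$ and all $\lambda\in[0,1]$. $F$ is a primitive function of $f$ means that $F$ is differentiable on $(a,b)$ and $F'(x)=f(x)$ for every $x\in(a,b)$. *)

(* Defs.v *)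
From mathcomp Require Import all_boot all_order all_algebra.
From mathcomp Require Import all_classical all_reals all_analysis.
Set Implicit Arguments.
Unset Strict Implicit.
Unset Printing Implicit Defensive.
Import Order.TTheory GRing.Theory Num.Theory.
Import numFieldNormedType.Exports.
Local Open Scope classical_set_scope.
Local Open Scope ring_scope.

(* The endpoints are extended reals, so that bounded and unbounded open
   intervals are both covered. *)
Definition open_interval (R : realType) (a b : \bar R) : set R :=
  [set x : R | (a < x%:E)%E /\ (x%:E < b)%E].

(* The library's convex_function takes functions out of the convex space
   attached to the R-module R^o; there x <| t |> y is t x + (1 - t) y. *)
Definition convex_on (R : realType) (D : set R) (f : R -> R) : Prop :=
  @convex_function R R^o D f.

(* Functions on D are represented by total functions on R.  When D is open,
   the derivative of F at a point of D depends only on the values of F on D. *)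
Definition primitive_on (R : realType) (D : set R) (f F : R -> R) : Prop :=
  forall x : R, D x -> is_derive x (1 : R) F (f x).

Lemma convex_onP (R : realType) (D : set R) (f : R -> R) :
  convex_on D f <->
  (forall x y l : R, D x -> D y -> 0 <= l <= 1 ->
     f (l * x + (1 - l) * y) <= l * f x + (1 - l) * f y).
Proof.
split=> [cf x y l Dx Dy /andP[l0 l1]|cf t x y].
  have := cf (Itv01 l0 l1) x y; rewrite !inE => /(_ Dx Dy).
  by rewrite !convRE.
rewrite !inE => Dx Dy; rewrite !convRE; apply: cf => //.
by apply/andP; split.
Qed.

(* Main.v *)
Require Import Defs.
From mathcomp Require Import all_boot all_order all_algebra.
From mathcomp Require Import all_classical all_reals all_analysis.
From mathcomp Require Import ring lra.
Import Order.TTheory GRing.Theory Num.Theory.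
Import numFieldNormedType.Exports.
Local Open Scope classical_set_scope.
Local Open Scope ring_scope.

(* Comparing the two inequalities on [x, y] with those on subintervals bounds
   f locally, first below and then above.  Dropping F gives midpoint convexity,
   and a locally bounded midpoint convex function is convex; it is then
   Lipschitz at each point, so the two bounds squeeze the difference quotients
   of F to f.  Conversely, F' = f and convexity make
   F(m + h) - F(m - h) - 2 f(m) h nondecreasing in h >= 0, and likewise the
   primitive of the chord of f over [x, y], minus F, on [x, y]. *)

(** * Division-free forms of the inequalities and of convexity *)

(* Multiplied by y - x, the inequalities also make sense at x = y. *)
Definition hermite_hadamard_on {R : realType} (D : set R) (f F : R -> R) :=
  forall x y : R, D x -> D y -> x <= y ->
    (y - x) * f ((x + y) / 2) <= F y - F x <= (y - x) * ((f x + f y) / 2).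

(** Convexity parametrised by the intermediate point [z] and cleared of the denominator [y - x]: it
    is linear in the values of [f] and harmless at [x = y]. *)
Definition below_chords_on {R : realType} (D : set R) (f : R -> R) :=
  forall x z y : R, D x -> D y -> x <= z <= y ->
    (y - x) * f z <= (y - z) * f x + (z - x) * f y.

Lemma open_interval_open_itv (R : realType) (a b : \bar R) :
  open (open_interval a b) /\ is_interval (open_interval a b).
Proof.
split; first by apply: openI; [exact: open_ereal_gt|exact: open_ereal_lt].
move=> x y [ax xb] [ay yb] z /andP[xz zy]; split.
- by apply: lt_le_trans ax _; rewrite lee_fin.
- by apply: le_lt_trans yb; rewrite lee_fin.
Qed.

Lemma open_ball_sub (R : realType) (D : set R) (x : R) : open D -> D x ->
  exists2 d : R, 0 < d & forall y, `|y - x| <= d -> D y.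
Proof.
move=> oD Dx; have /nbhs_ballP[e /= e0 eD] := open_nbhs_nbhs (conj oD Dx).
exists (e / 2) => [|y yx]; first by rewrite divr_gt0.
by apply: eD; rewrite /ball /= distrC (le_lt_trans yx)// gtr_pMr// invf_lt1// ltr1n.
Qed.

Lemma hermite_hadamard_onP (R : realType) (D : set R) (f F : R -> R) :
  (forall x y : R, D x -> D y -> x != y ->
     f ((x + y) / 2) <= (F y - F x) / (y - x) /\
     (F y - F x) / (y - x) <= (f x + f y) / 2)
  <-> hermite_hadamard_on D f F.
Proof.
split=> [H x y Dx Dy|H].
  rewrite le_eqVlt => /predU1P[->|xy]; first by rewrite !subrr !mul0r lexx.
  have [] := H _ _ Dx Dy (negbT (lt_eqF xy)).
  by rewrite ler_pdivlMr ?subr_gt0// ler_pdivrMr ?subr_gt0// ![_ * (y - x)]mulrC => -> ->.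
(* The difference quotient and both bounds are symmetric in [x] and [y]. *)
suff lt_case x y : D x -> D y -> x < y ->
     f ((x + y) / 2) <= (F y - F x) / (y - x) /\
     (F y - F x) / (y - x) <= (f x + f y) / 2.
  move=> x y Dx Dy; rewrite neq_lt => /orP[xy|yx]; first exact: lt_case.
  have -> : (F y - F x) / (y - x) = (F x - F y) / (x - y).
    by rewrite -(opprB (F x)) -(opprB x) invrN mulrNN.
  by rewrite [x + y]addrC [f x + _]addrC; exact: lt_case.
move=> Dx Dy xy; have /andP[] := H _ _ Dx Dy (ltW xy).
by rewrite ler_pdivlMr ?subr_gt0// ler_pdivrMr ?subr_gt0// ![_ * (y - x)]mulrC.
Qed.

Lemma below_chords_convex_on (R : realType) (D : set R) (f : R -> R) :
  below_chords_on D f <-> convex_on D f.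
Proof.
rewrite convex_onP; split=> [H|H x z y Dx Dy /andP[xz zy]].
  suff lt_case x y l : D x -> D y -> 0 <= l <= 1 -> x < y ->
      f (l * x + (1 - l) * y) <= l * f x + (1 - l) * f y.
    move=> x y l Dx Dy l01; case: (ltgtP x y) => [xy|yx|<-].
    - exact: lt_case.
    - have l01' : 0 <= 1 - l <= 1.
        by move/andP: l01 => [l0 l1]; rewrite subr_ge0 l1 gerBl.
      have := lt_case y x (1 - l) Dy Dx l01' yx.
      by rewrite subKr [_ * y + _]addrC [_ * f y + _]addrC.
    - by rewrite -!mulrDl [l + _]addrC subrK !mul1r.
  move=> Dx Dy /andP[l0 l1] xy.
  have : x <= l * x + (1 - l) * y <= y by apply/andP; split; nra.
  move=> /(H _ _ _ Dx Dy) le_chord.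
  rewrite -(ler_pM2l (_ : 0 < y - x)) ?subr_gt0//.
  by apply: le_trans le_chord _; rewrite le_eqVlt; apply/orP; left; apply/eqP; ring.
have [xy|yx] := ltP x y; last first.
  have xzE : x = z by lra.
  have -> : y = x by lra.
  by rewrite -xzE !subrr !mul0r addr0.
have yx0 : y - x != 0 by rewrite subr_eq0 gt_eqF.
have := H x y ((y - z) / (y - x)) Dx Dy.
have -> : 1 - (y - z) / (y - x) = (z - x) / (y - x) by field.
have -> : (y - z) / (y - x) * x + (z - x) / (y - x) * y = z by field.
rewrite divr_ge0 ?subr_ge0 ?(ltW xy)// ler_pdivrMr ?subr_gt0//.
rewrite mul1r lerB// => /(_ isT) /(ler_wpM2l (_ : 0 <= y - x)).
rewrite subr_ge0 (ltW xy) => /(_ isT) /le_trans; apply.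
by rewrite le_eqVlt; apply/orP; left; apply/eqP; field.
Qed.

(** * Local bounds and convexity of f *)

(* Splitting [x, y] at z, the upper bounds on both halves add up to an affine
   function of f z, which must stay above F y - F x. *)
Lemma hermite_hadamard_lbound (R : realType) (D : set R) (f F : R -> R)
    (x y : R) :
  is_interval D -> hermite_hadamard_on D f F -> D x -> D y -> x < y ->
  exists L : R, forall z, x <= z <= y -> L <= f z.
Proof.
(* The three inequalities give [2 * (y - x) * f ((x + y) / 2) <= (z - x) * f x + (y - x) * f z + (y
   - z) * f y]; the absolute values make the bound independent of [z]. *)
move=> iD H Dx Dy xy; exists (2 * f ((x + y) / 2) - `|f x| - `|f y|) => z xzy.
have Dz := iD x y Dx Dy z xzy; move/andP: xzy => [xz zy].
rewrite -(ler_pM2l (_ : 0 < y - x)) ?subr_gt0//.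
have /andP[+ _] := H x y Dx Dy (ltW xy).
have /andP[_ +] := H x z Dx Dz xz.
have /andP[_ +] := H z y Dz Dy zy.
have : (z - x) * f x <= (y - x) * `|f x|.
  rewrite (@le_trans _ _ ((z - x) * `|f x|))//.
    by rewrite ler_wpM2l ?subr_ge0 ?ler_norm.
  by rewrite ler_wpM2r ?lerD2r.
have : (y - z) * f y <= (y - x) * `|f y|.
  rewrite (@le_trans _ _ ((y - z) * `|f y|))//.
    by rewrite ler_wpM2l ?subr_ge0 ?ler_norm.
  by rewrite ler_wpM2r ?lerD2l ?lerN2.
by move=> *; lra.
Qed.

(* A lower bound for f makes F minus a linear function nondecreasing, hence F
   bounded, and f z is below a difference quotient of F of fixed width. *)
Lemma hermite_hadamard_ubound (R : realType) (D : set R) (f F : R -> R)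
    (x y : R) :
  open D -> is_interval D -> hermite_hadamard_on D f F ->
  D x -> D y -> x <= y ->
  exists M : R, forall z, x <= z <= y -> f z <= M.
Proof.
move=> oD iD H Dx Dy xy.
have [d1 d10 D1] := open_ball_sub _ _ _ oD Dx.
have [d2 d20 D2] := open_ball_sub _ _ _ oD Dy.
(* With this margin, [z - e] and [z + e] stay in [D] for every [z] in [x, y]. *)
pose e := Num.min d1 d2.
have e0 : 0 < e by rewrite lt_min d10.
have Dx' : D (x - e) by apply: D1; rewrite addrAC subrr sub0r normrN gtr0_norm// ge_min lexx.
have Dy' : D (y + e) by apply: D2; rewrite addrAC subrr add0r gtr0_norm// ge_min lexx orbT.
have xy' : x - e < y + e by lra.
have [L HL] := hermite_hadamard_lbound _ _ _ _ _ _ iD H Dx' Dy' xy'.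
have HF u v : x - e <= u -> u <= v -> v <= y + e -> (v - u) * L <= F v - F u.
  move=> xu uv vy.
  have Du : D u by apply: (iD _ _ Dx' Dy'); apply/andP; split; lra.
  have Dv : D v by apply: (iD _ _ Dx' Dy'); apply/andP; split; lra.
  have /andP[+ _] := H u v Du Dv uv; apply: le_trans.
  by apply: ler_wpM2l; [rewrite subr_ge0|apply: HL; apply/andP; split; lra].
(* The increment of [F] over [z - e, z + e] is the total one minus those over [x - e, z - e] and
   [z + e, y + e], which have total length [y - x] and so contribute at least [(y - x) * L]. *)
exists ((F (y + e) - F (x - e) - (y - x) * L) / (2 * e)) => z /andP[xz zy].
rewrite ler_pdivlMr ?mulr_gt0//.
have Du : D (z - e) by apply: (iD _ _ Dx' Dy'); apply/andP; split; lra.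
have Dv : D (z + e) by apply: (iD _ _ Dx' Dy'); apply/andP; split; lra.
have /andP[+ _] := H (z - e) (z + e) Du Dv ltac:(lra).
have -> : (z - e + (z + e)) / 2 = z by field.
have := HF (x - e) (z - e) ltac:(lra) ltac:(lra) ltac:(lra).
have := HF (z + e) (y + e) ltac:(lra) ltac:(lra) ltac:(lra).
by move=> *; lra.
Qed.

(* If g is f minus its chord over [x, y], midpoint convexity at t with the
   nearer endpoint, where g = 0, gives g t <= sup g / 2; so sup g <= 0. *)
Lemma midpoint_convex_bounded (R : realType) (D : set R) (f : R -> R) :
  is_interval D ->
  (forall x y, D x -> D y -> f ((x + y) / 2) <= (f x + f y) / 2) ->
  (forall x y, D x -> D y -> x <= y ->
     exists M, forall z, x <= z <= y -> f z <= M) ->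
  below_chords_on D f.
Proof.
move=> iD mid bnd x z y Dx Dy xzy.
have xy : x <= y by case/andP: xzy => /le_trans; apply.
(* The difference from the chord, scaled by [y - x] to avoid division. *)
pose g t := (y - x) * f t - (y - t) * f x - (t - x) * f y.
pose E := [set g t | t in [set t | x <= t <= y]].
have Ez : E (g z) by exists z.
have gx : g x = 0 by rewrite /g; ring.
have gy : g y = 0 by rewrite /g; ring.
have gmid u v : x <= u <= y -> x <= v <= y -> g ((u + v) / 2) <= (g u + g v) / 2.
  move=> uI vI; have := mid u v (iD _ _ Dx Dy _ uI) (iD _ _ Dx Dy _ vI).
  by move/(ler_wpM2l (_ : 0 <= y - x)); rewrite subr_ge0 /g => /(_ xy) ?; lra.
have ubE : has_ubound E.
  have [M HM] := bnd x y Dx Dy xy.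
  exists ((y - x) * M + (y - x) * `|f x| + (y - x) * `|f y|).
  move=> _ [t /= tI <-].
  have /(ler_wpM2l (_ : 0 <= y - x)) := HM t tI; rewrite subr_ge0 => /(_ xy).
  move/andP: tI => [xt ty].
  have : - ((y - t) * f x) <= (y - x) * `|f x|.
    rewrite -mulrN (@le_trans _ _ ((y - t) * `|f x|))//.
      by rewrite ler_wpM2l ?subr_ge0// -normrN ler_norm.
    by rewrite ler_wpM2r ?lerD2l ?lerN2.
  have : - ((t - x) * f y) <= (y - x) * `|f y|.
    rewrite -mulrN (@le_trans _ _ ((t - x) * `|f y|))//.
      by rewrite ler_wpM2l ?subr_ge0// -normrN ler_norm.
    by rewrite ler_wpM2r ?lerD2r.
  by rewrite /g => *; lra.
have half : sup E <= sup E / 2.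
  apply: ge_sup; first by exists (g z).
  move=> _ [t /= /andP[xt ty] <-].
  (* Reflecting the nearer endpoint through [t] gives a point that is still in [x, y]. *)
  have [tm|mt] := leP t ((x + y) / 2).
  - have sI : x <= 2 * t - x <= y by apply/andP; split; lra.
    have := gmid x (2 * t - x) ltac:(by rewrite lexx) sI.
    have -> : (x + (2 * t - x)) / 2 = t by field.
    have : g (2 * t - x) <= sup E by apply: ub_le_sup => //; exists (2 * t - x).
    by rewrite gx => *; lra.
  - have sI : x <= 2 * t - y <= y by apply/andP; split; lra.
    have := gmid (2 * t - y) y sI ltac:(by rewrite lexx andbT).
    have -> : (2 * t - y + y) / 2 = t by field.
    have : g (2 * t - y) <= sup E by apply: ub_le_sup => //; exists (2 * t - y).
    by rewrite gy => *; lra.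
have := ub_le_sup ubE Ez; rewrite {1}/g => ?; lra.
Qed.

Lemma hermite_hadamard_convex (R : realType) (D : set R) (f F : R -> R) :
  open D -> is_interval D -> hermite_hadamard_on D f F -> below_chords_on D f.
Proof.
move=> oD iD H; apply: midpoint_convex_bounded => //; last first.
  by move=> x y; exact: (@hermite_hadamard_ubound _ D f F).
suff mid x y : D x -> D y -> x < y -> f ((x + y) / 2) <= (f x + f y) / 2.
  move=> x y Dx Dy; case: (ltgtP x y) => [|yx|<-]; first exact: mid.
  - by rewrite [x + y]addrC [f x + _]addrC; exact: mid.
  - have -> : (x + x) / 2 = x by field.
    lra.
move=> Dx Dy xy; have /andP[h1 h2] := H x y Dx Dy (ltW xy).
by have := le_trans h1 h2; rewrite ler_pM2l ?subr_gt0.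
Qed.

(** * Differentiability of F *)

(** The chord from [x] to the endpoint on the side of [h] bounds [f (x + h)] above; the chord from
    the opposite endpoint to [x + h], which passes above [x], bounds it below. *)
Lemma below_chords_lipschitz_at (R : realType) (D : set R) (f : R -> R)
    (x d : R) :
  below_chords_on D f -> 0 < d -> D (x - d) -> D (x + d) -> is_interval D ->
  exists2 K : R, 0 <= K & forall h, `|h| <= d -> `|f (x + h) - f x| <= K * `|h|.
Proof.
move=> H d0 Dl Dr iD.
have xd : x - d < x + d by lra.
have Dx : D x by apply: (iD _ _ Dl Dr); apply/andP; split; lra.
pose A := f (x + d) - f x; pose B := f (x - d) - f x.
exists ((`|A| + `|B|) / d) => [|h hd].
  by rewrite divr_ge0 ?addr_ge0// ltW.
rewrite mulrAC ler_pdivlMr//.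
rewrite -[X in _ * X](gtr0_norm d0) -normrM.
move: hd; rewrite ler_norml => /andP[dh hd].
have Dh : D (x + h) by apply: (iD _ _ Dl Dr); apply/andP; split; lra.
have conc (s P Q w : R) : 0 <= s -> - (s * P) <= w <= s * Q -> `|w| <= (`|P| + `|Q|) * s.
  move=> s0 /andP[w1 w2]; rewrite ler_norml; apply/andP; split.
    have := ler_wpM2l s0 (ler_norm P); have := mulr_ge0 s0 (normr_ge0 Q).
    by move=> *; lra.
  have := ler_wpM2l s0 (ler_norm Q); have := mulr_ge0 s0 (normr_ge0 P).
  by move=> *; lra.
have [h0|h0] := leP 0 h.
- rewrite [`|h|]ger0_norm// [`|A| + _]addrC; apply: (conc h B A) => //.
  have := H x (x + h) (x + d) Dx Dr ltac:(apply/andP; split; lra).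
  have := H (x - d) x (x + h) Dl Dh ltac:(apply/andP; split; lra).
  by rewrite /A /B => ? ?; apply/andP; split; lra.
- rewrite [`|h|]ltr0_norm//; apply: (conc (- h) A B); first by lra.
  have := H (x - d) (x + h) x Dl Dx ltac:(apply/andP; split; lra).
  have := H (x + h) x (x + d) Dh Dr ltac:(apply/andP; split; lra).
  by rewrite /A /B => ? ?; apply/andP; split; lra.
Qed.

Lemma is_derive_quotient_bound (R : realType) (F : R -> R) (x l K d : R) :
  0 < d -> 0 <= K ->
  (forall h, h != 0 -> `|h| <= d -> `|(F (x + h) - F x) / h - l| <= K * `|h|) ->
  is_derive x (1 : R) F l.
Proof.
move=> d0 K0 H.
have cvgl : (fun h => h^-1 *: (F (h *: 1 + x) - F x)) @ (0 : R)^' --> l.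
  apply/cvgrPdist_le => e e0; near=> h.
  have hd : `|h| <= d by near: h; apply: dnbhs0_le.
  (* [K] may be 0, hence the division by [K + 1]. *)
  have he : `|h| <= e / (K + 1).
    by near: h; apply: dnbhs0_le; rewrite divr_gt0// ltr_wpDl.
  have h0 : h != 0 by near: h; exact: nbhs_dnbhs_neq.
  rewrite distrC /GRing.scale /= mulr1 [h + x]addrC mulrC.
  apply: le_trans (H h h0 hd) _.
  move: he; rewrite ler_pdivlMr ?ltr_wpDl// => he.
  have := normr_ge0 h => ?; lra.
split; first by apply/cvg_ex; exists l.
exact: cvg_lim.
Unshelve. all: by end_near. Qed.

(** The quotient over [x] and [x + h] lies between [f (x + h / 2)] and [(f x + f (x + h)) / 2], both
    within [K * |h| / 2] of [f x] by the Lipschitz bound. *)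
Lemma hermite_hadamard_primitive (R : realType) (D : set R) (f F : R -> R) :
  open D -> is_interval D -> hermite_hadamard_on D f F -> primitive_on D f F.
Proof.
move=> oD iD H x Dx.
have [d d0 Dd] := open_ball_sub _ _ _ oD Dx.
have cf := hermite_hadamard_convex _ _ _ _ oD iD H.
have Dl : D (x - d) by apply: Dd; rewrite addrAC subrr sub0r normrN gtr0_norm.
have Dr : D (x + d) by apply: Dd; rewrite addrAC subrr add0r gtr0_norm.
have [K K0 HK] := below_chords_lipschitz_at _ _ _ _ _ cf d0 Dl Dr iD.
apply: (is_derive_quotient_bound _ _ _ _ K d) => // h h0 hd.
have Dh : D (x + h) by apply: Dd; rewrite addrAC subrr add0r.
have [_ /(_ H) Q] := hermite_hadamard_onP _ D f F.
have [] := Q x (x + h) Dx Dh.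
  by rewrite -subr_eq0 opprD addrA subrr sub0r oppr_eq0.
have -> : x + h - x = h by ring.
have -> : (x + (x + h)) / 2 = x + h / 2 by field.
have hh : `|h / 2| = `|h| / 2 by rewrite normrM normfV [`|2|]gtr0_norm.
have := HK h hd; have := HK (h / 2).
rewrite hh => /(_ ltac:(have := normr_ge0 h => ?; lra)).
rewrite !ler_norml => /andP[? ?] /andP[? ?] ? ?.
have ? := mulr_ge0 K0 (normr_ge0 h).
by apply/andP; split; lra.
Qed.

(** * The converse, by monotone auxiliary functions *)

Lemma is_derive_ge0_le (R : realType) (G g : R -> R) (x y : R) : x <= y ->
  (forall t, x <= t <= y -> is_derive t (1 : R) G (g t) /\ 0 <= g t) ->
  G x <= G y.
Proof.
move=> xy dG.
have [||c] := @MVT_segment R G g x y xy.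
- move=> t; rewrite in_itv /= => /andP[xt ty].
  by have [|] := dG t; first by rewrite !ltW.
- apply: derivable_within_continuous => t; rewrite in_itv /= => tI.
  by have [? _] := dG t tI.
- rewrite in_itv /= => cI GE; rewrite -subr_ge0 GE mulr_ge0 ?subr_ge0//.
  by have [_] := dG c cI.
Qed.

Lemma convex_primitive_hermite_hadamard (R : realType) (D : set R)
    (f F : R -> R) :
  is_interval D -> below_chords_on D f -> primitive_on D f F ->
  hermite_hadamard_on D f F.
Proof.
move=> iD cf dF x y Dx Dy.
rewrite le_eqVlt => /predU1P[->|xy]; first by rewrite !subrr !mul0r lexx.
have dFt t : x <= t <= y -> is_derive t (1 : R) F (f t) by move=> /(iD _ _ Dx Dy)/dF.
apply/andP; split.
(* Lower bound: [G 0 = 0], and [G c] is [F y - F x - (y - x) * f m]. *)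
- pose m := (x + y) / 2; pose c := (y - x) / 2.
  pose G h := F (m + h) - F (m - h) - 2 * f m * h.
  have : G 0 <= G c.
    apply: (@is_derive_ge0_le R G (fun h => f (m + h) + f (m - h) - 2 * f m)).
      by rewrite /c; lra.
    move=> h /andP[h0 hc].
    have Ir : x <= m + h <= y by rewrite /m /c in hc *; apply/andP; split; lra.
    have Il : x <= m - h <= y by rewrite /m /c in hc *; apply/andP; split; lra.
    split.
      have dr : is_derive h (1 : R) (fun h => m + h) 1.
        by apply: is_derive_eq; ring.
      have dl : is_derive h (1 : R) (fun h => m - h) (-1).
        by apply: is_derive_eq; ring.
      have ? := @is_derive1_comp R F (fun h => m + h) h _ _ (dFt _ Ir) dr.
      have ? := @is_derive1_comp R F (fun h => m - h) h _ _ (dFt _ Il) dl.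
      have -> : G = (F \o (fun h => m + h)) - (F \o (fun h => m - h))
                    - (2 * f m) *: id by [].
      apply: is_derive_eq.
      by rewrite /GRing.scale /= mulr1 mulrN1 opprK mulr1.
    have := cf (m - h) m (m + h) (iD _ _ Dx Dy _ Il) (iD _ _ Dx Dy _ Ir).
    have -> : m - h <= m <= m + h by apply/andP; split; lra.
    (* The chord inequality carries a factor [h], so it says nothing at [h = 0], where the
       derivative of [G] vanishes. *)
    have [->|hn0] := eqVneq h 0; first by rewrite addr0 subr0 => _; lra.
    have hp : 0 < h by rewrite lt_neqAle eq_sym hn0.
    move=> /(_ isT) ?; rewrite -(pmulr_rge0 _ hp); lra.
  rewrite /G addr0 subr0 mulr0 subrr subr0.
  have -> : m + c = y by rewrite /m /c; field.
  have -> : m - c = x by rewrite /m /c; field.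
  by rewrite /c => *; lra.
(* Upper bound: with [s] the slope of the chord, [G] is a primitive of the chord minus [F], and the
   chord integrates to [(y - x) * ((f x + f y) / 2)]. *)
- pose s := (f y - f x) / (y - x).
  pose G t := f x * t + s / 2 * (t - x) ^+ 2 - F t.
  have yx0 : y - x != 0 by rewrite subr_eq0 gt_eqF.
  have : G x <= G y.
    apply: (@is_derive_ge0_le R G (fun t => f x + s * (t - x) - f t)).
      exact: ltW.
    move=> t tI; split.
      have ? := dFt t tI.
      have d1 : is_derive t (1 : R) (fun t => t - x) 1.
        by apply: is_derive_eq; ring.
      have -> : G = f x *: id + (s / 2) *: ((fun t => t - x) ^+ 2) - F.
        by apply/funext => u; rewrite /G !fctE.
      apply: is_derive_eq.
      by rewrite /GRing.scale /= !mulr1 expr1; field.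
    have := cf x t y Dx Dy tI.
    rewrite -(pmulr_rge0 _ (_ : 0 < y - x)) ?subr_gt0//.
    have -> : (y - x) * (f x + s * (t - x) - f t)
      = (y - x) * f x + (f y - f x) * (t - x) - (y - x) * f t by rewrite /s; field.
    by move=> *; lra.
  rewrite /G subrr expr0n /= mulr0 addr0.
  have -> : s / 2 * (y - x) ^+ 2 = (f y - f x) * (y - x) / 2 by rewrite /s; field.
  by move=> *; lra.
Qed.

Theorem theorem3 (R : realType) (a b : \bar R) (hab : (a < b)%E)
    (f F : R -> R) :
  (forall x y : R, open_interval a b x -> open_interval a b y -> x != y ->
     f ((x + y) / 2) <= (F y - F x) / (y - x) /\
     (F y - F x) / (y - x) <= (f x + f y) / 2)
  <->
  (convex_on (open_interval a b) f /\ primitive_on (open_interval a b) f F).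
Proof.
have [oD iD] := open_interval_open_itv R a b.
rewrite hermite_hadamard_onP -below_chords_convex_on.
split=> [H|[cf dF]]; last exact: convex_primitive_hermite_hadamard.
split; last exact: hermite_hadamard_primitive.
exact: (hermite_hadamard_convex R _ f F).
Qed.
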